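(* Let $K$ be locally compact and discretely valued. Let $f\in K[x]$ be a univariate polynomial that splits over $K$, and let $B_0\in\mathcal B^1$ be a rational disc of positive radius containing a root of $f$. Let $B_0,B_1,B_2,\dots$ be a sequence of discs obtained by running the best-first descent algorithm with objective $\ell=|f|$ indefinitely, i.e. for every $i\ge0$, $B_{i+1}$ is a (possibly randomly chosen) element of $\operatorname{argmin}_{C\in\mathcal C(B_i)}|f|(C)$. Then this sequence converges (in $\mathcal B^1$) to a root of $f$ in $K$.
   Context: $K$ is a field with a non-trivial valuation $\mathrm{val}\colon K\to\mathbb R\cup\{\infty\}$, complete with respect to the associated non-Archimedean absolute value $|a|=\exp(-\mathrm{val}(a))$. $\hat K$ is the completion of an algebraic closure of $K$, with the unique extension of $|\cdot|$. For $a\in K$, $r\in\mathbb R_{\ge0}$ put $B_{\mathcal B}(a,r)=\{z\in\hat K: |a-z|\le r\}$; $\mathcal B^1$ is the set of all of these discs, and $K\subseteq\mathcal B^1$ via $a\mapsto B_{\mathcal B}(a,0)$. The metric on $\mathcal B^1$ is $d_{\mathcal B}(B_{\mathcal B}(a,r),B_{\mathcal B}(a',r'))=|r-r'|$ if one disc contains the other, and $d_{\mathcal B}(B,B')=d_{\mathcal B}(B,B\vee B')+d_{\mathcal B}(B\vee B',B')$ with $B\vee B'=B_{\mathcal B}(a,|a-a'|)$ otherwise. For $f\in K[x]$, $|f|(B)=\sup_{z\in B}|f(z)|$. A disc $B_{\mathcal B}(a,r)$ is rational if $r\in|K|$. For a rational disc $B$ of positive radius, $\mathcal C(B)$ is the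 (finite) set of its children: the rational discs $C\subsetneq B$ in $\mathcal B^1$ such that no rational disc lies strictly between $C$ and $B$. Explicitly, with $\pi$ a uniformiser, these are the discs in $\mathcal B^1$ centred at points of $B\cap K$ with radius $|\pi|$ times that of $B$. *)

(* Defs.v *)
From HB Require Import structures.
From mathcomp Require Import all_boot all_order all_algebra.
From mathcomp Require Import all_classical all_reals all_analysis.
From mathcomp Require Import ring.

Set Implicit Arguments.
Unset Strict Implicit.
Unset Printing Implicit Defensive.
Import Order.TTheory GRing.Theory Num.Theory.
Local Open Scope classical_set_scope.
Local Open Scope ring_scope.

Record valuation (R : realType) (K : fieldType) := Valuation {
  vfun :> K -> \bar R;
  vfun_neqNy : forall x, vfun x != -oo%E;
  vfun_eqy : forall x, vfun x = +oo%E <-> x = 0;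
  vfunM : forall x y, vfun (x * y) = (vfun x + vfun y)%E;
  vfunD : forall x y, (Order.min (vfun x) (vfun y) <= vfun (x + y))%E }.

Definition vabs (R : realType) (K : fieldType) (v : valuation R K) (x : K) : R :=
  fine (expeR (- v x)%E).

Section AbsoluteValue.
Context {R : realType} {K : fieldType} (v : valuation R K).

Lemma vabs_fin x : x != 0 -> exists2 r : R, v x = r%:E & vabs v x = expR (- r).
Proof.
move=> x0; case E : (v x) => [r| |].
- by exists r => //; rewrite /vabs E.
- by move/vfun_eqy: E x0 => ->; rewrite eqxx.
- by have := vfun_neqNy v x; rewrite E.
Qed.

Lemma vabs0 : vabs v 0 = 0.
Proof. by rewrite /vabs; have /vfun_eqy -> := erefl (0 : K). Qed.

Lemma vabs_gt0 x : (0 < vabs v x) = (x != 0).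
Proof.
have [->|x0] := eqVneq x 0; first by rewrite vabs0 ltxx.
by have [r _ ->] := vabs_fin x0; rewrite expR_gt0.
Qed.

Lemma vabs_ge0 x : 0 <= vabs v x.
Proof.
by have [->|x0] := eqVneq x 0; rewrite ?vabs0// ltW// vabs_gt0.
Qed.

Lemma vabs_eq0 x : vabs v x = 0 -> x = 0.
Proof. by move=> h; apply/eqP/negPn; rewrite -vabs_gt0 h ltxx. Qed.

Lemma vabsM x y : vabs v (x * y) = vabs v x * vabs v y.
Proof.
have [->|x0] := eqVneq x 0; first by rewrite mul0r vabs0 mul0r.
have [->|y0] := eqVneq y 0; first by rewrite mulr0 vabs0 mulr0.
have [r Er ->] := vabs_fin x0; have [s Es ->] := vabs_fin y0.
by rewrite /vabs vfunM Er Es /= opprD expRD.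
Qed.

Lemma vabs1 : vabs v 1 = 1.
Proof.
have h : vabs v 1 != 0 by rewrite gt_eqF// vabs_gt0 oner_neq0.
by apply: (mulfI h); rewrite -vabsM !mulr1.
Qed.

Lemma vabsX x n : vabs v (x ^+ n) = vabs v x ^+ n.
Proof.
by elim: n => [|n IH]; rewrite ?expr0 ?vabs1// !exprS vabsM IH.
Qed.

Lemma vabsN x : vabs v (- x) = vabs v x.
Proof.
suff h : vabs v (-1) = 1 by rewrite -mulN1r vabsM h mul1r.
apply/eqP; rewrite -(@pexpr_eq1 _ _ 2)// ?vabs_ge0//.
by rewrite -vabsX sqrrN expr1n vabs1.
Qed.

Lemma vabsB x y : vabs v (x - y) = vabs v (y - x).
Proof. by rewrite -vabsN opprB. Qed.

Lemma vabsD x y : vabs v (x + y) <= Num.max (vabs v x) (vabs v y).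
Proof.
have [->|x0] := eqVneq x 0; first by rewrite add0r le_max lexx orbT.
have [->|y0] := eqVneq y 0; first by rewrite addr0 le_max lexx.
have [->|z0] := eqVneq (x + y) 0; first by rewrite vabs0 le_max vabs_ge0.
have [r Er ->] := vabs_fin x0; have [s Es ->] := vabs_fin y0.
have [t Et ->] := vabs_fin z0.
have := vfunD v x y.
by rewrite Er Es Et ge_min le_max !lee_fin !ler_expR !lerN2.
Qed.

Lemma vabs_tri y x z :
  vabs v (x - z) <= vabs v (x - y) + vabs v (y - z).
Proof.
rewrite -(subrKA y x); apply: le_trans (vabsD _ _) _.
by rewrite ge_max lerDl lerDr !vabs_ge0.
Qed.

End AbsoluteValue.

(* The carrier of [v] with the metric |x - y|, so that the library's notions
   for uniform and topological spaces apply to it. *)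
Definition valued (R : realType) (K : fieldType) (v : valuation R K) : Type := K.

Section ValuedMetric.
Context (R : realType) (K : fieldType) (v : valuation R K).

Let vdist (x y : valued v) : R := vabs v ((x : K) - (y : K)).

Let vdistxx x : vdist x x = 0.
Proof. by rewrite /vdist subrr vabs0. Qed.

Let vdist_eq0 x y : vdist x y = 0 -> x = y.
Proof. by move/vabs_eq0/eqP; rewrite subr_eq0 => /eqP. Qed.

Let vdist_sym x y : vdist x y = vdist y x.
Proof. exact: vabsB. Qed.

Let vdist_tri y x z : vdist x z <= vdist x y + vdist y z.
Proof. exact: vabs_tri. Qed.

HB.instance Definition _ := Choice.copy (valued v) K.
HB.instance Definition _ := isPointed.Build (valued v) (0 : K).
HB.instance Definition _ := @isMetric.Build R (valued v) vdist
  vdistxx vdist_eq0 vdist_sym vdist_tri.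

End ValuedMetric.

Definition nontrivial_valuation (R : realType) (K : fieldType)
    (v : valuation R K) :=
  exists2 x : K, x != 0 & v x <> 0%E.

Definition complete_valuation (R : realType) (K : fieldType)
    (v : valuation R K) :=
  forall F : set_system (valued v), ProperFilter F -> cauchy F -> cvg F.

Definition uniformiser (R : realType) (K : fieldType) (v : valuation R K)
    (p : K) :=
  exists2 w : R, v p = w%:E /\ 0 < w &
    forall x : K, x != 0 -> exists m : int, v x = (w *~ m)%:E.

Definition discretely_valued (R : realType) (K : fieldType)
    (v : valuation R K) :=
  exists p : K, uniformiser v p.

Definition algebraic_closure (K L : fieldType) (j : {rmorphism K -> L}) :=
  GRing.closed_field_axiom L /\ forall u : L, algebraicOver j u.

(* [L] needs no valuation of its own: that of [Khat] restricts to a valuation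
   of [L] extending [v], and there is only one since [v] is complete. *)
Definition completed_algebraic_closure (R : realType) (K Khat : fieldType)
    (v : valuation R K) (vh : valuation R Khat)
    (iota : {rmorphism K -> Khat}) :=
  (forall x : K, vh (iota x) = v x) /\ complete_valuation vh /\
  exists (L : fieldType) (j : {rmorphism K -> L}) (k : {rmorphism L -> Khat}),
    [/\ algebraic_closure j,
        forall x : K, iota x = k (j x) &
        dense (range k : set (valued vh))].

(* The zero polynomial counts as split. *)
Definition splits (K : fieldType) (f : {poly K}) :=
  exists (c : K) (rs : seq K), f = c *: \prod_(a <- rs) ('X - a%:P).

Definition argmin (T : Type) (R : realType) (l : T -> R) (A : set T) : set T :=
  [set x | A x /\ forall y, A y -> l x <= l y].

Section Discs.
Context {R : realType} {K Khat : fieldType}.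
Context (v : valuation R K) (vh : valuation R Khat).
Context (iota : {rmorphism K -> Khat}).

Definition disc (a : K) (r : R) : set Khat :=
  [set z | vabs vh (iota a - z) <= r].

Definition discs : set (set Khat) :=
  [set B | exists (a : K) (r : R), 0 <= r /\ B = disc a r].

(* A centre and the radius of a disc. The centre is a choice; the radius is
   determined by the disc as a subset of Khat, since the value group of Khat is
   dense. See [disc_radiusE], and [disc_distE] for the distance. *)
Definition disc_center_radius (B : set Khat) : K * R :=
  xget (0, 0) [set p : K * R | 0 <= p.2 /\ B = disc p.1 p.2].

Definition disc_center B := (disc_center_radius B).1.
Definition disc_radius B := (disc_center_radius B).2.

(* Only meaningful when neither disc contains the other. *)
Definition disc_join (B B' : set Khat) : set Khat :=
  disc (disc_center B) (vabs v (disc_center B - disc_center B')).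

Definition disc_dist (B B' : set Khat) : R :=
  let d C C' := `|disc_radius C - disc_radius C'| in
  if `[< B `<=` B' \/ B' `<=` B >] then d B B'
  else d B (disc_join B B') + d (disc_join B B') B'.

Definition rational_disc (B : set Khat) :=
  exists a c : K, B = disc a (vabs v c).

Definition children (B : set Khat) : set (set Khat) :=
  [set C | [/\ rational_disc C, C `<` B &
    forall D, rational_disc D -> ~ (C `<` D /\ D `<` B)]].

Definition disc_sup (f : {poly K}) (B : set Khat) : R :=
  sup [set vabs vh (map_poly iota f).[z] | z in B].

Context (vnontriv : nontrivial_valuation v).
Context (Khat_completed : completed_algebraic_closure v vh iota).

Lemma vabs_iota x : vabs vh (iota x) = vabs v x.
Proof. by case: Khat_completed => h _; rewrite /vabs h. Qed.

Lemma vabs_dense (s r : R) : 0 <= s -> s < r ->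
  exists z : Khat, s < vabs vh z <= r.
Proof.
wlog s0 : s / 0 < s => [wl|_].
  rewrite le_eqVlt => /orP[/eqP <-|s0] sr; last exact: wl (ltW s0) sr.
  have r2 : 0 < r / 2 by rewrite divr_gt0.
  have [|z /andP[h1 h2]] := wl _ r2 (ltW r2).
    by rewrite ltr_pdivrMr// ltr_pMr// ltr1n.
  by exists z; rewrite h2 (lt_trans r2).
move=> sr; have r0 : 0 < r := lt_trans s0 sr.
have [y [y0 [w w0 yw]]] : exists y : K, y != 0 /\
    exists2 w : R, 0 < w & vabs v y = expR w.
  case: vnontriv => x x0; have [t xt xe] := vabs_fin v x0.
  rewrite xt => /eqP; rewrite eqe => t0.
  have [tn|tp|te] := ltgtP t 0; last by rewrite te eqxx in t0.
    by exists x; split => //; exists (- t); rewrite ?oppr_gt0.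
  exists x^-1; split; first by rewrite invr_eq0.
  exists t => //; apply: (@mulfI _ (vabs v x)).
    by rewrite gt_eqF// vabs_gt0.
  by rewrite -vabsM divff// vabs1 xe -expRD addNr expR0.
have d0 : 0 < ln r - ln s by rewrite subr_gt0 ltr_ln ?posrE.
pose n := (Num.truncn (w / (ln r - ln s))).+1.
have n0 : 0 < n%:R :> R by rewrite ltr0n.
have wn : w / n%:R < ln r - ln s.
  by rewrite ltr_pdivrMr// -ltr_pdivrMl// mulrC truncnS_gt.
have [u un] : exists u : Khat, u ^+ n = iota y.
  case: Khat_completed => _ [_] [L [j [k [[Lc _] kj _]]]].
  have [u] := Lc n (fun i => if i == 0%N then j y else 0) (ltn0Sn _).
  rewrite big_ord_recl /= expr0 mulr1 big1 ?addr0 => [ue|i _]; last first.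
    by rewrite mul0r.
  by exists (k u); rewrite -rmorphXn ue kj.
have u0 : u != 0.
  by apply: contraNneq y0 => uE; rewrite -(fmorph_eq0 iota) -un uE expr0n.
have [t _ ut] := vabs_fin vh u0.
have wt : w = - t *+ n.
  apply: expR_inj; rewrite -yw -vabs_iota -un vabsX ut -expRM_natl mulr_natl.
  by [].
have t0 : 0 < - t by move: w0; rewrite wt pmulrn_lgt0.
have tw : w / n%:R = - t by rewrite wt -[X in X / _]mulr_natr mulfK// gt_eqF.
rewrite tw in wn.
have uz (m : int) : vabs vh (u ^ m) = expR (- t * m%:~R).
  have uX k : vabs vh (u ^+ k) = expR (- t * k%:R).
    by rewrite vabsX ut -expRM_natr.
  case: m => k; first by rewrite uX.
  apply: (@mulfI _ (vabs vh (u ^+ k.+1))).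
    by rewrite gt_eqF// vabs_gt0 expf_neq0.
  rewrite -vabsM /= mulfV ?expf_neq0// vabs1 uX -expRD NegzE mulrNz.
  by rewrite -mulrDr addrN mulr0 expR0.
exists (u ^ Num.floor (ln r / - t)); rewrite uz.
have hr := floor_le (ln r / - t); have hs := floorD1_gt (ln r / - t).
set m := Num.floor _ in hr hs *.
rewrite ler_pdivlMr// mulrC in hr.
rewrite ltr_pdivrMr// mulrC intrD mulrDr mulr1 in hs.
apply/andP; split.
  rewrite -{1}(lnK s0) ltr_expR -(ltrD2r (- t)) (lt_trans _ hs)//.
  by rewrite addrC -ltrBrDr.
by rewrite -(lnK r0) ler_expR.
Qed.

Lemma disc_sub_radius a a' r r' : 0 <= r' ->
  disc a r `<=` disc a' r' -> r <= r'.
Proof.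
move=> r'0 sub; rewrite leNgt; apply/negP => rr'.
have [z /andP[z1 z2]] := vabs_dense r'0 rr'.
have r0 : 0 <= r := ltW (le_lt_trans r'0 rr').
have /sub /= ha : disc a r (iota a) by rewrite /disc /= subrr vabs0.
have /sub /= hz : disc a r (iota a - z) by rewrite /disc /= opprB addrC subrK.
have := vabsD vh (iota a' - (iota a - z)) (- (iota a' - iota a)).
rewrite vabsN (_ : _ + _ = z); last by ring.
rewrite le_max => /orP[] h.
  by have := le_lt_trans (le_trans h hz) z1; rewrite ltxx.
by have := le_lt_trans (le_trans h ha) z1; rewrite ltxx.
Qed.

Lemma disc_inj a a' r r' : 0 <= r -> 0 <= r' ->
  disc a r = disc a' r' -> r = r'.
Proof.
move=> r0 r'0 e; apply/eqP; rewrite eq_le.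
by apply/andP; split; [apply: (@disc_sub_radius a a')|
  apply: (@disc_sub_radius a' a)] => //; rewrite e.
Qed.

Lemma disc_center_radiusP a r : 0 <= r ->
  0 <= disc_radius (disc a r) /\
  disc a r = disc (disc_center (disc a r)) (disc_radius (disc a r)).
Proof.
move=> r0; rewrite /disc_radius /disc_center /disc_center_radius.
by case: xgetP => [[b s] _ //|/(_ (a, r))]; case.
Qed.

Lemma disc_radiusE a r : 0 <= r -> disc_radius (disc a r) = r.
Proof.
move=> r0; have [s0 e] := disc_center_radiusP a r0.
exact/esym/(disc_inj r0 s0 e).
Qed.

Lemma disc_centerP a r : 0 <= r -> disc a r = disc (disc_center (disc a r)) r.
Proof.
by move=> r0; have [_ {1}->] := disc_center_radiusP a r0; rewrite disc_radiusE.
Qed.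

Lemma disc_subP a a' r r' : 0 <= r ->
  vabs v (a - a') <= r' -> r <= r' -> disc a r `<=` disc a' r'.
Proof.
rewrite /disc => r0 aa rr z /= az.
rewrite -(subrKA (iota a)); apply: le_trans (vabsD _ _ _) _.
by rewrite ge_max (le_trans az rr) -rmorphB vabs_iota vabsB aa.
Qed.

Lemma disc_centerB a r : 0 <= r -> vabs v (disc_center (disc a r) - a) <= r.
Proof.
move=> r0; have := disc_centerP a r0; set b := disc_center _ => e.
have : disc a r (iota b) by rewrite e /disc /= subrr vabs0.
by rewrite /disc /= -rmorphB vabs_iota vabsB.
Qed.

Lemma vabsD_eq x y : vabs v y < vabs v x -> vabs v (x + y) = vabs v x.
Proof.
move=> yx; apply/eqP; rewrite eq_le; apply/andP; split.
  by apply: le_trans (vabsD _ _ _) _; rewrite ge_max lexx ltW.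
have := vabsD v (x + y) (- y); rewrite addrK vabsN le_max => /orP[//|].
by rewrite leNgt yx.
Qed.

Lemma disc_joinE a a' r r' : 0 <= r -> 0 <= r' ->
  ~ (disc a r `<=` disc a' r' \/ disc a' r' `<=` disc a r) ->
  disc_join (disc a r) (disc a' r') = disc a (vabs v (a - a')).
Proof.
move=> r0 r'0 sub; rewrite /disc_join.
set b := disc_center _; set b' := disc_center _.
have ba : vabs v (b - a) <= r := disc_centerB a r0.
have ba' : vabs v (b' - a') <= r' := disc_centerB a' r'0.
have [ra r'a] : r < vabs v (a - a') /\ r' < vabs v (a - a').
  split; rewrite ltNge; apply/negP => h; apply: sub.
    have [rr|rr] := leP r' r; [right|left; apply: disc_subP (ltW rr) => //].
      by apply: disc_subP => //; rewrite vabsB.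
    exact: le_trans h (ltW rr).
  have [rr|rr] := leP r r'; [left|right; apply: disc_subP (ltW rr) => //].
    exact: disc_subP.
  by rewrite vabsB (le_trans h (ltW rr)).
have -> : vabs v (b - b') = vabs v (a - a').
  rewrite (_ : b - b' = a - a' + ((b - a) - (b' - a'))); last by ring.
  apply: vabsD_eq; apply: le_lt_trans (vabsD _ _ _) _.
  by rewrite gt_max (le_lt_trans ba)// vabsN (le_lt_trans ba').
rewrite eqEsubset; split; apply: disc_subP; rewrite ?vabs_ge0// ?ltW//.
  exact: le_lt_trans ba ra.
by rewrite vabsB (le_lt_trans ba ra).
Qed.

Lemma disc_distE a a' r r' : 0 <= r -> 0 <= r' ->
  disc_dist (disc a r) (disc a' r') =
  if `[< disc a r `<=` disc a' r' \/ disc a' r' `<=` disc a r >]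
  then `|r - r'|
  else `|r - vabs v (a - a')| + `|vabs v (a - a') - r'|.
Proof.
move=> r0 r'0; rewrite /disc_dist; case: asboolP => sub.
  by rewrite !disc_radiusE.
by rewrite disc_joinE// !disc_radiusE// vabs_ge0.
Qed.

End Discs.

(* Main.v *)
(** Let r be the radius of B_i and p a uniformiser. By discreteness, a child of
    B_i centred at b that contains no root is at distance at least r from every
    root x, so |z - x| <= |b - x| for all z in B_i, and hence |f| <= |f(b)| on
    B_i. On a child containing a root y, the factor |z - y| <= |p| r <=
    |p| |b - y| improves this to |f| <= |p| |f(b)| < |f(b)|. So the descent
    never leaves the discs containing a root; the radii |p|^i r_0 tend to 0, and
    since f has finitely many roots, one of them lies in all the B_i. If f = 0
    there is no pigeonhole, but any limit point provided by completeness will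
    do. *)

Require Import Defs.
From mathcomp Require Import all_boot all_order all_algebra.
From mathcomp Require Import all_classical all_reals all_analysis.
Import Order.TTheory GRing.Theory Num.Theory.
Import numFieldNormedType.Exports.
Set Implicit Arguments.
Unset Strict Implicit.
Unset Printing Implicit Defensive.
Local Open Scope classical_set_scope.
Local Open Scope ring_scope.

Section Uniformiser.
Context {R : realType} {K : fieldType} (v : valuation R K) (p : K).
Context (hp : uniformiser v p).

Lemma uniformiser_neq0 : p != 0.
Proof.
by case: hp => w [vp _] _; apply: contra_eqN vp => /eqP/vfun_eqy ->.
Qed.

Lemma vabs_uniformiser_lt1 : vabs v p < 1.
Proof.
case: hp => w [vp w0] _; have [r] := vabs_fin v uniformiser_neq0.
by rewrite vp => -[<-] ->; rewrite expR_lt1 oppr_lt0.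
Qed.

(** Values of nonzero elements are integer multiples of the value [w] of [p], so two distinct ones
    differ by at least [w]. *)
Lemma vabs_discrete x y : vabs v x < vabs v y -> vabs v x <= vabs v (p * y).
Proof.
have [->|x0] := eqVneq x 0; first by rewrite vabs0 vabs_ge0.
have [->|y0] := eqVneq y 0; first by rewrite vabs0 ltNge vabs_ge0.
have [r] := vabs_fin v x0; have [s] := vabs_fin v y0.
have [t] := vabs_fin v uniformiser_neq0.
case: hp => w [-> w0] vZ; rewrite vabsM.
have [m ->] := vZ _ x0; have [n ->] := vZ _ y0.
move=> [<-] -> [<-] -> [<-] ->; rewrite ltr_expR -expRD ler_expR.
rewrite ltrN2 -opprD lerN2 -[X in X + _]mulr1z -mulrzDr.
by rewrite ltr_pMz2l// ler_pMz2l// addrC lezD1.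
Qed.

End Uniformiser.

Section Descent.
Context {R : realType} {K Khat : fieldType}.
Context (v : valuation R K) (vh : valuation R Khat).
Context (iota : {rmorphism K -> Khat}).
Context (vnontriv : nontrivial_valuation v).
Context (Khat_completed : completed_algebraic_closure v vh iota).

Local Notation disc := (disc vh iota).
Let vabsi := vabs_iota Khat_completed.

Lemma mem_disc a r x : disc a r (iota x) <-> vabs v (a - x) <= r.
Proof. by rewrite /Defs.disc /= -rmorphB vabsi. Qed.

Lemma disc_proper_radius a a' r r' : 0 <= r -> 0 <= r' ->
  disc a r `<` disc a' r' -> r < r'.
Proof.
move=> r0 r'0 [sub nsub]; rewrite ltNge; apply/negP => rr; apply: nsub.
apply: (disc_subP Khat_completed) => //; apply: le_trans rr.
by apply/mem_disc/sub/mem_disc; rewrite subrr vabs0.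
Qed.

(** The point is nested in the disc, so the distance is the difference of the radii. This reduces
    convergence to a root to two facts: the root lies in every disc, and the radii tend to 0. *)
Lemma disc_dist_point a r x : 0 <= r -> disc a r (iota x) ->
  disc_dist v vh iota (disc a r) (disc x 0) = r.
Proof.
move=> r0 /mem_disc ax; rewrite (disc_distE vnontriv Khat_completed)//.
rewrite asboolT; first by rewrite subr0 ger0_norm.
by right; apply: (disc_subP Khat_completed) => //; rewrite vabsB.
Qed.

Lemma vabs_horner_split (c : K) (rs : seq K) (z : Khat) :
  vabs vh (map_poly iota (c *: \prod_(a <- rs) ('X - a%:P))).[z] =
  vabs v c * \prod_(a <- rs) vabs vh (z - iota a).
Proof.
rewrite map_polyZ hornerZ vabsM vabsi rmorph_prod horner_prod; congr (_ * _).
rewrite (big_morph _ (vabsM vh) (vabs1 vh)); apply: eq_bigr => a _.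
by rewrite rmorphB /= map_polyX map_polyC hornerXsubC.
Qed.

Section Children.
Context {p : K} (hp : uniformiser v p).

(** No absolute value lies strictly between those of [p * c] and [c], so maximality among the proper
    rational subdiscs pins down the radius, while the centre stays free. *)
Lemma childrenP a c C : c != 0 ->
  children v vh iota (disc a (vabs v c)) C <->
  exists2 b, disc a (vabs v c) (iota b) & C = disc b (vabs v (p * c)).
Proof.
move=> c0.
have lt_pc : vabs v (p * c) < vabs v c.
  by rewrite vabsM gtr_pMl ?vabs_gt0// (vabs_uniformiser_lt1 hp).
have sub_pc b : disc a (vabs v c) (iota b) ->
    disc b (vabs v (p * c)) `<` disc a (vabs v c).
  move=> /mem_disc ab; split.
    apply: (disc_subP Khat_completed); rewrite ?vabs_ge0// ?(ltW lt_pc)//.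
    by rewrite vabsB.
  move=> /(disc_sub_radius vnontriv Khat_completed (vabs_ge0 _ _)).
  by rewrite leNgt lt_pc.
split=> [[[b [e ->]] sub nD]|[b ab ->]].
  have /(sub.1) ab : disc b (vabs v e) (iota b).
    by apply/mem_disc; rewrite subrr vabs0 vabs_ge0.
  exists b => //; congr disc; apply/eqP.
  have ec : vabs v e < vabs v c.
    by apply: disc_proper_radius sub; rewrite vabs_ge0.
  (* Discreteness bounds the radius from above. Were it smaller still, the disc about [b] of radius
     [vabs v (p * c)] would lie strictly between. *)
  rewrite eq_le (vabs_discrete hp)//= leNgt; apply/negP => epc.
  apply: (nD (disc b (vabs v (p * c)))); first by exists b, (p * c).
  split; last exact: sub_pc.
  split.
    apply: (disc_subP Khat_completed); rewrite ?subrr ?vabs0 ?vabs_ge0//.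
    exact: ltW.
  move=> /(disc_sub_radius vnontriv Khat_completed (vabs_ge0 _ _)).
  by rewrite leNgt epc.
split; [by exists b, (p * c) | exact: sub_pc |].
move=> D [d [e ->]] [bd da].
have := disc_proper_radius _ _ da; rewrite !vabs_ge0 => /(_ isT isT).
have := disc_proper_radius _ _ bd; rewrite !vabs_ge0 => /(_ isT isT) h.
by move=> /(vabs_discrete hp); rewrite leNgt h.
Qed.

Lemma argmin_child_root (k : K) (rs : seq K) a c C :
  let f := k *: \prod_(x <- rs) ('X - x%:P) in
  k != 0 -> c != 0 ->
  (exists2 x, x \in rs & disc a (vabs v c) (iota x)) ->
  argmin (disc_sup vh iota f) (children v vh iota (disc a (vabs v c))) C ->
  exists2 x, x \in rs & C (iota x).
Proof.
move=> f k0 c0 [y yrs ay] [/(childrenP _ _ c0)[b ab ->] Cmin].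
apply: contrapT => noroot.
have far x : x \in rs -> vabs v c <= vabs v (b - x).
  move=> xrs; rewrite leNgt; apply/negP => /(vabs_discrete hp) bx.
  by apply: noroot; exists x => //; apply/mem_disc.
have near_far z x : disc a (vabs v c) z -> x \in rs ->
    vabs vh (z - iota x) <= vabs v (b - x).
  move=> az xrs; rewrite -(subrKA (iota b)).
  apply: le_trans (vabsD _ _ _) _; rewrite ge_max -rmorphB vabsi lexx andbT.
  apply: le_trans (far x xrs); rewrite -(subrKA (iota a)).
  apply: le_trans (vabsD _ _ _) _; rewrite ge_max vabsB az -rmorphB vabsi.
  exact/mem_disc.
(* This is the value of [|f|] at the centre [b] of the rootless child; by [near_far] it bounds [|f|]
   on the whole parent disc. *)
pose m := vabs v k * \prod_(x <- rs) vabs v (b - x).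
(* Positivity makes the final comparison [m <= vabs v p * m] absurd. *)
have m0 : 0 < m.
  rewrite mulr_gt0 ?vabs_gt0// big_seq prodr_gt0// => x xrs.
  by rewrite (lt_le_trans _ (far x xrs))// vabs_gt0.
have pc_c d z : disc a (vabs v c) (iota d) -> disc d (vabs v (p * c)) z ->
    disc a (vabs v c) z.
  move=> ad; have [_ [+ _] _] :=
    (childrenP _ _ c0).2 (ex_intro2 _ _ d ad erefl).
  exact.
have sup_b : m <= disc_sup vh iota f (disc b (vabs v (p * c))).
  (* The supremum of an unbounded set takes a default value, so a bound on the child is required
     first; [m] itself serves. *)
  apply: ub_le_sup.
    exists m => _ [z bz <-]; rewrite vabs_horner_split ler_wpM2l ?vabs_ge0//.
    rewrite big_seq [leRHS]big_seq ler_prod// => x xrs.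
    by rewrite vabs_ge0 near_far//; apply: pc_c bz.
  exists (iota b); first by apply/mem_disc; rewrite subrr vabs0 vabs_ge0.
  rewrite vabs_horner_split; congr (_ * _); apply: eq_bigr => x _.
  by rewrite -rmorphB vabsi.
have sup_y : disc_sup vh iota f (disc y (vabs v (p * c))) <= vabs v p * m.
  apply: ge_sup.
    eexists; exists (iota y) => //.
    by apply/mem_disc; rewrite subrr vabs0 vabs_ge0.
  move=> _ [z yz <-]; rewrite vabs_horner_split mulrCA ler_wpM2l ?vabs_ge0//.
  (* A single occurrence of [y] is split off and yields the gain [vabs v p]. The other factors,
     including further copies of a multiple root, are compared by [near_far]. *)
  rewrite (big_rem y)//= [in leRHS](big_rem y)//= mulrA.
  rewrite ler_pM ?vabs_ge0 ?prodr_ge0//.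
  - by move=> ? _; exact: vabs_ge0.
  - rewrite vabsB (le_trans yz)// vabsM ler_wpM2l ?vabs_ge0//; exact: far.
  - rewrite big_seq [leRHS]big_seq ler_prod// => x /mem_rem xrs.
    by rewrite vabs_ge0 near_far//; apply: pc_c yz.
have /Cmin : children v vh iota (disc a (vabs v c)) (disc y (vabs v (p * c))).
  by apply/childrenP => //; exists y.
move=> /(le_trans sup_b)/le_trans/(_ sup_y).
by rewrite leNgt gtr_pMl// (vabs_uniformiser_lt1 hp).
Qed.

Lemma descent_disc a c (B : nat -> set Khat) : c != 0 ->
  B 0%N = disc a (vabs v c) ->
  (forall i, children v vh iota (B i) (B i.+1)) ->
  forall i, exists b, B i = disc b (vabs v (p ^+ i * c)).
Proof.
move=> c0 B0 Bch; elim=> [|i [b Bi]]; first by exists a; rewrite expr0 mul1r.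
have := Bch i; rewrite Bi => /childrenP[|d _ ->].
  by rewrite mulf_neq0// expf_neq0// (uniformiser_neq0 hp).
by exists d; rewrite exprS -mulrA.
Qed.

End Children.

(** By nesting, all later centres lie within [r i] of [a i], so the centres form a Cauchy sequence
    in [K]. Its limit stays in each disc by the ultrametric inequality. *)
Lemma nested_discs_cap (B : nat -> set Khat) (r : nat -> R) :
  complete_valuation v -> (forall i, 0 < r i) -> r @ \oo --> (0 : R) ->
  (forall i, exists a, B i = disc a (r i)) ->
  (forall i, B i.+1 `<=` B i) ->
  exists x, forall i, B i (iota x).
Proof.
move=> vcomplete r0 r_cvg /choice[a Ba] Bsub.
have a_in i j : (i <= j)%N -> vabs v (a i - a j) <= r i.
  move=> ij; apply/mem_disc; rewrite -Ba.
  have sub : B j `<=` B i.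
    by move: ij => /subnKC <-; elim: (j - i)%N => [|n IH];
      rewrite ?addn0// addnS; exact: subset_trans IH.
  by apply: sub; rewrite Ba; apply/mem_disc; rewrite subrr vabs0 ltW.
have /vcomplete : cauchy (fmap (a : nat -> valued v) \oo).
  apply/cauchy_exP => e e0.
  have [N _ rN] : \forall i \near \oo, r i < e.
    by apply: (cvgr_lt 0 r_cvg).
  exists (a N); exists N => // j /= Nj.
  by apply: le_lt_trans (a_in _ _ Nj) (rN _ _) => /=.
move=> /cvg_ex[x ax]; exists x => i; rewrite Ba; apply/mem_disc.
(* The index [maxn N i] is late enough for the centre both to be within [r i] of the limit and to
   lie in [B i]. *)
have /cvg_ballP/(_ _ (r0 i))[N _ /(_ (maxn N i) (leq_maxl _ _)) xa] := ax.
rewrite -(subrKA (a (maxn N i))); apply: le_trans (vabsD _ _ _) _.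
by rewrite ge_max a_in ?leq_maxr//= vabsB ltW.
Qed.

End Descent.

Lemma antitone_seq_pigeonhole (T : eqType) (s : seq T) (P : nat -> T -> Prop) :
  (forall i x, P i.+1 x -> P i x) ->
  (forall i, exists2 x, x \in s & P i x) ->
  exists2 x, x \in s & forall i, P i x.
Proof.
move=> Pdec; have Ple i j x : (i <= j)%N -> P j x -> P i x.
  move=> /subnKC <-; elim: (j - i)%N => [|n IH]; first by rewrite addn0.
  by rewrite addnS => /Pdec.
elim: s => [/(_ 0%N)[]//|y s IH Ps].
have [Py|/existsNP[N nPy]] := pselect (forall i, P i y).
  by exists y; rewrite ?mem_head.
have [i|x xs Px] := IH; last by exists x; rewrite ?inE ?xs ?orbT.
have [x + Px] := Ps (maxn i N); rewrite inE => /orP[/eqP xy|xs].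
  by case: nPy; rewrite -xy; apply: Ple Px; rewrite leq_maxr.
by exists x => //; apply: Ple Px; rewrite leq_maxl.
Qed.

Theorem proposition77 (R : realType) (K Khat : fieldType)
    (v : valuation R K) (vh : valuation R Khat)
    (iota : {rmorphism K -> Khat})
    (vnontriv : nontrivial_valuation v)
    (vcomplete : complete_valuation v)
    (Khat_completed : completed_algebraic_closure v vh iota)
    (Kloc : locally_compact [set: valued v])
    (vdiscrete : discretely_valued v)
    (f : {poly K}) (fsplit : splits f)
    (B : nat -> set Khat)
    (B0_disc : discs vh iota (B 0%N))
    (B0_rational : rational_disc v vh iota (B 0%N))
    (B0_pos : 0 < disc_radius vh iota (B 0%N))
    (B0_root : exists2 z : Khat, B 0%N z & root (map_poly iota f) z)
    (B_descent : forall i : nat,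
       argmin (disc_sup vh iota f) (children v vh iota (B i)) (B i.+1)) :
  exists2 x : K, root f x &
    disc_dist v vh iota (B i) (disc vh iota x 0) @[i --> \oo] --> (0 : R).
Proof.
have [p hp] := vdiscrete.
have [a0 [c B0E]] := B0_rational.
have c0 : c != 0.
  move: B0_pos; rewrite B0E (disc_radiusE vnontriv Khat_completed).
    by rewrite vabs_gt0.
  exact: vabs_ge0.
have Bch i : children v vh iota (B i) (B i.+1) := (B_descent i).1.
have BE := descent_disc vnontriv Khat_completed hp c0 B0E Bch.
have pc0 i : p ^+ i * c != 0.
  by rewrite mulf_neq0// expf_neq0// (uniformiser_neq0 hp).
have Bsub i : B i.+1 `<=` B i by case: (Bch i) => _ [].
have r_cvg : vabs v (p ^+ i * c) @[i --> \oo] --> (0 : R).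
  rewrite (_ : (fun i => _) = geometric (vabs v c) (vabs v p)).
    apply: cvg_geometric.
    by rewrite ger0_norm ?vabs_ge0// (vabs_uniformiser_lt1 hp).
  by apply/funext => i; rewrite vabsM vabsX mulrC.
suff [x fx Bx] : exists2 x, root f x & forall i, B i (iota x).
  exists x => //; rewrite (_ : (fun i => _) = (fun i => vabs v (p ^+ i * c)))//.
  apply/funext => i; have := Bx i; have [b ->] := BE i.
  by apply: (disc_dist_point vnontriv Khat_completed); rewrite vabs_ge0.
case: fsplit B0_root B_descent => k [rs ->].
(* For [k = 0] every point is a root, so any common point of the discs suffices. *)
have [->|k0] := eqVneq k 0 => [_ _|[z B0z /rootP fz] B_descent'].
  have [|x Bx] := nested_discs_cap Khat_completed vcomplete _ r_cvg BE Bsub.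
    by move=> i; rewrite vabs_gt0.
  by exists x; rewrite ?scale0r ?root0.
have [i x /Bsub//|i|x xrs Bx] :=
  @antitone_seq_pigeonhole _ rs (fun i x => B i (iota x)); last first.
  by exists x; rewrite ?rootZ ?root_prod_XsubC.
elim: i => [|i].
  (* The given root [z] lies only in [Khat]. Since [f] splits, some factor vanishes at [z], so [z]
     is the image of an element of [rs]. *)
  have /esym/eqP := vabs_horner_split Khat_completed k rs z.
  rewrite fz vabs0 mulf_eq0 gt_eqF ?vabs_gt0//= prodf_seq_eq0.
  move=> /hasP[x xrs /eqP/vabs_eq0/subr0_eq zx].
  by exists x; rewrite // -zx.
have := B_descent' i; have [b ->] := BE i => Bi IH.
exact: (argmin_child_root vnontriv Khat_completed hp k0 (pc0 i) IH).
Qed.
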